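(* Let $\Gamma$ be a ribbon graph of a connected trivalent graph $G(V,E)$. For $\nu\in\{0,1\}^{V}$ let $\Gamma_\nu$ be the corresponding state graph. Then the vertex polynomial of $\Gamma$, evaluated for any $n\in\mathbb{N}$, is $$V(\Gamma,n)=\sum_{|\nu|\text{ even}}\#\{\text{partial $n$-face colorings of }\Gamma_\nu\}-\sum_{|\nu|\text{ odd}}\#\{\text{partial $n$-face colorings of }\Gamma_\nu\}.$$
   Context: Graphs are finite multigraphs: loops and multiple edges are allowed, and so are ''vertex-less'' edges (circles, also regarded as loops). Trivalent means every vertex has degree 3 (a loop at a vertex counts twice). A ribbon graph $\Gamma$ of $G$ is a surface with boundary in which $G$ is embedded and which deformation retracts onto $G$; combinatorially it is given by a cyclic ordering of the half-edges at each vertex and a sign for each edge (a disc for each vertex, a band for each edge, a half-twist in the bands of negative edges; a vertex-less edge gives an annulus or Möbius band). The faces of $\Gamma$ are the discs capping its boundary circles. For $\nu\in\{0,1\}^V$, the state graph $\Gamma_\nu$ is the ribbon graph obtained from $\Gamma$ by inserting, for each vertex $v$ with $\nu_v=1$, a half-twist in each of the three half-bands at $v$ (two half-twists in one band cancel); $k_\nu$ is its number of boundary circles and $|\nu|=\sum_v\nu_v$. The vertex polynomial is $V(\Gamma,n)=\sum_{\nu\in\{0,1\}^V}(-1)^{|\nu|}n^{k_\nu}$. A partial $n$-face coloring of a ribbon graph is an assignment of one of $n$ fixed colors to each face such that at every vertex at least two different colors occur among the faces incident to that vertex (at its three corners). *)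

(* Defs.v *)
From mathcomp Require Import all_boot all_order all_fingroup all_algebra.

Set Implicit Arguments.
Unset Strict Implicit.
Unset Printing Implicit Defensive.

Import GRing.Theory.

(* Each edge e of [mg_edge] has the two half-edges (e, false) and (e, true), so
   that loops and multiple edges are allowed; [mg_circle] is the set of
   vertex-less edges. *)
Record multigraph := Multigraph {
  mg_vertex : finType;
  mg_edge : finType;
  mg_circle : finType;
  mg_end : mg_edge * bool -> mg_vertex
}.

Definition half_edge (G : multigraph) : finType := (mg_edge G * bool)%type.

Definition opposite (G : multigraph) (h : half_edge G) : half_edge G :=
  (h.1, ~~ h.2).

Definition degree (G : multigraph) (v : mg_vertex G) : nat :=
  #|[set h : half_edge G | mg_end h == v]|.

Definition trivalent (G : multigraph) : Prop :=
  forall v : mg_vertex G, degree v = 3.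

(* A circle is joined to nothing else, so a connected graph is either a single
   circle or a circle-free graph whose nonempty vertex set is connected. *)
Definition adjacent (G : multigraph) : rel (mg_vertex G + mg_circle G) :=
  fun x y =>
    match x, y with
    | inl v, inl w =>
        [exists h : half_edge G, (mg_end h == v) && (mg_end (opposite h) == w)]
    | _, _ => false
    end.

Definition graph_connected (G : multigraph) : Prop :=
  (0 < #|{: mg_vertex G + mg_circle G}|) /\
  forall x y : mg_vertex G + mg_circle G, connect (@adjacent G) x y.

(* [rg_rot] sends a half-edge to its successor in the cyclic ordering at its
   vertex; its cycles are thus the sets of half-edges at the vertices.
   [rg_neg] is true on the negative edges; a negative circle stands for a
   Moebius band, a positive one for an annulus. *)
Record ribbon_graph (G : multigraph) := RibbonGraph {
  rg_rot : {perm half_edge G};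
  rg_neg : mg_edge G + mg_circle G -> bool;
  rg_rotP : forall h h' : half_edge G,
    (h' \in porbit rg_rot h) = (mg_end h' == mg_end h)
}.

(* Points meeting every boundary circle of the surface: the two ends
   [inl (h, b)] of the segment along which the half-band of h is glued to the
   disc of its vertex, b = true being the end next to the half-band of
   [rg_rot h]; one point on the disc of each vertex of degree 0; one point on
   either side of the band of each circle. *)
Definition boundary_point (G : multigraph) : finType :=
  ((half_edge G * bool) +
   ({v : mg_vertex G | degree v == 0} + (mg_circle G * bool)))%type.

(* Two points joined by an arc of the boundary: a corner at a vertex, which goes
   from (h, true) to (rot h, false), or a side of a band. With both vertex discs
   oriented, an untwisted band exchanges the labels of the two sides and a
   twisted one preserves them. *)
Definition boundary_arc (G : multigraph) (R : ribbon_graph G) :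
    rel (boundary_point G) :=
  fun p q =>
    match p, q with
    | inl (h, b), inl (h', b') =>
        [|| [&& b, ~~ b' & h' == rg_rot R h],
            [&& b', ~~ b & h == rg_rot R h'] |
            (h' == opposite h) && (b' == (b (+) ~~ rg_neg R (inl h.1)))]
    | inr (inr (c, b)), inr (inr (c', b')) =>
        [&& c' == c, b' != b & rg_neg R (inr c)]
    | _, _ => false
    end.

Definition boundary_class (G : multigraph) (R : ribbon_graph G)
    (p : boundary_point G) : {set boundary_point G} :=
  [set q | connect (boundary_arc R) p q].

Definition boundary_circles (G : multigraph) (R : ribbon_graph G) :
    {set {set boundary_point G}} :=
  [set boundary_class R p | p : boundary_point G].

(* A face is identified with the boundary circle that it caps. *)
Definition face (G : multigraph) (R : ribbon_graph G) : finType :=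
  {F : {set boundary_point G} | F \in boundary_circles R}.

Definition face_of (G : multigraph) (R : ribbon_graph G)
    (p : boundary_point G) : face R :=
  exist (fun F => F \in boundary_circles R) (boundary_class R p)
    (imset_f (boundary_class R) (isT : p \in predT)).

(* The face at the corner between h and [rg_rot R h]. *)
Definition corner_face (G : multigraph) (R : ribbon_graph G)
    (h : half_edge G) : face R :=
  face_of R (inl (h, true)).

Definition state (G : multigraph) : finType := {ffun mg_vertex G -> bool}.

Definition state_size (G : multigraph) (nu : state G) : nat :=
  #|[set v | nu v]|.

(* The half-bands of e at its two ends receive a half-twist according to nu; two
   half-twists (as on a loop) cancel. *)
Definition state_neg (G : multigraph) (R : ribbon_graph G) (nu : state G)
    (x : mg_edge G + mg_circle G) : bool :=
  match x with
  | inl e => rg_neg R (inl e) (+) nu (mg_end (e, false))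
                              (+) nu (mg_end (e, true))
  | inr c => rg_neg R (inr c)
  end.

Definition state_graph (G : multigraph) (R : ribbon_graph G) (nu : state G) :
    ribbon_graph G :=
  RibbonGraph (state_neg R nu) (rg_rotP R).

Definition vertex_poly (G : multigraph) (R : ribbon_graph G) : {poly int} :=
  (\sum_(nu : state G)
     (-1) ^+ state_size nu * 'X^#|boundary_circles (state_graph R nu)|)%R.

Definition partial_face_coloring (G : multigraph) (R : ribbon_graph G) (n : nat)
    (f : {ffun face R -> 'I_n}) : bool :=
  [forall v : mg_vertex G, exists h : half_edge G, exists h' : half_edge G,
     [&& mg_end h == v, mg_end h' == v &
         f (corner_face R h) != f (corner_face R h')]].

Definition num_partial_face_colorings (G : multigraph) (R : ribbon_graph G)
    (n : nat) : nat :=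
  #|[set f : {ffun face R -> 'I_n} | partial_face_coloring f]|.

(* Main.v *)
Require Import Defs.
From mathcomp Require Import all_boot all_order all_fingroup all_algebra.
Import GRing.Theory.

(** A coloring of the faces of a state graph is the same as a coloring of the
    boundary points that is constant along the boundary arcs; the set of
    boundary points does not depend on the state.  Fix a coloring [g] of the
    points that has a single color around some vertex v.  Twisting the
    half-bands at v only exchanges points around v, which have the same color,
    so [g] is constant along the arcs for a state [nu] iff it is so for [nu]
    flipped at v.  The signed sum over the states compatible with [g] therefore
    vanishes, and only the partial face colorings contribute. *)

Local Open Scope ring_scope.

Lemma oppositeK {G : multigraph} : involutive (@opposite G).
Proof. by case=> e b; rewrite /opposite /= negbK. Qed.

Lemma mg_end_rot {G : multigraph} (R : ribbon_graph G) (h : half_edge G) :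
  mg_end (rg_rot R h) = mg_end h.
Proof. by apply/eqP; rewrite -(rg_rotP R) (mem_porbit _ 1). Qed.

(** Symmetry makes [connect] an equivalence, so that every point of a boundary circle determines the
    same class. *)
Lemma boundary_arc_sym {G : multigraph} (R : ribbon_graph G) :
  symmetric (boundary_arc R).
Proof.
case=> [[h b]|[u|[c b]]] [[h' b']|[u'|[c' b']]] //=; last first.
  rewrite [c' == c]eq_sym [b' == b]eq_sym.
  by case: eqP => // ->.
rewrite orbA [RHS]orbA; congr (_ || _); first exact: orbC.
rewrite -(inv_eq (@oppositeK G) h h') [opposite h == h']eq_sym.
case: eqP => //= ->.
by case: b b' (rg_neg R _) => [] [] [].
Qed.

Definition arc_constant {G : multigraph} (R : ribbon_graph G) {T : eqType}
    (g : boundary_point G -> T) : bool :=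
  [forall p, forall q, boundary_arc R p q ==> (g p == g q)].

Lemma arc_constantP {G : multigraph} {R : ribbon_graph G} {T : eqType}
    (g : boundary_point G -> T) :
  reflect (forall p q, boundary_arc R p q -> g p = g q) (arc_constant R g).
Proof.
apply: (iffP forallP) => H p; last first.
  by apply/forallP => q; apply/implyP => /H ->.
by move=> q a; move/forallP/(_ q)/implyP/(_ a)/eqP: (H p).
Qed.

Lemma arc_constant_connect {G : multigraph} {R : ribbon_graph G} {T : eqType}
    {g : boundary_point G -> T} {p q} :
  arc_constant R g -> connect (boundary_arc R) p q -> g p = g q.
Proof.
move=> /arc_constantP gR /connectP[s].
by elim: s p => [|x s IHs] p /= => [_ ->|/andP[/gR -> /IHs]].
Qed.

Lemma face_of_connect {G : multigraph} {R : ribbon_graph G} {p q} :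
  connect (boundary_arc R) p q -> face_of R p = face_of R q.
Proof.
move=> pq; apply/val_inj/setP => x; rewrite !inE.
exact: (same_connect (sym_connect_sym (boundary_arc_sym R)) pq).
Qed.

Lemma face_ofP {G : multigraph} {R : ribbon_graph G} (F : face R) :
  exists p, F = face_of R p.
Proof.
by have /imsetP[p _ Fp] := valP F; exists p; apply: val_inj.
Qed.

Lemma face_of_eq_connect {G : multigraph} {R : ribbon_graph G} {p q} :
  face_of R p = face_of R q -> connect (boundary_arc R) p q.
Proof.
by move/(congr1 val)/setP/(_ q); rewrite !inE connect0.
Qed.

Definition point_coloring {G : multigraph} {R : ribbon_graph G} {n : nat}
    (f : {ffun face R -> 'I_n}) : {ffun boundary_point G -> 'I_n} :=
  [ffun p => f (face_of R p)].

Lemma point_coloring_inj {G : multigraph} {R : ribbon_graph G} {n : nat} :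
  injective (@point_coloring G R n).
Proof.
move=> f1 f2 /ffunP eqf; apply/ffunP => F.
by have [p ->] := face_ofP F; move: (eqf p); rewrite !ffunE.
Qed.

Lemma codom_point_coloring {G : multigraph} {R : ribbon_graph G} {n : nat}
    (g : {ffun boundary_point G -> 'I_n}) :
  arc_constant R g -> exists f : {ffun face R -> 'I_n}, g = point_coloring f.
Proof.
move=> gR.
have rep F : exists p, F == face_of R p.
  by have [p ->] := face_ofP F; exists p.
(* A face takes the color of some point chosen on its circle; arc-constancy makes the choice
   immaterial. *)
exists [ffun F => g (xchoose (rep F))]; apply/ffunP => p; rewrite !ffunE.
apply: (arc_constant_connect gR); apply: face_of_eq_connect.
exact/eqP/(xchooseP (rep (face_of R p))).
Qed.

Lemma arc_constant_point_coloring {G : multigraph} {R : ribbon_graph G} {n : nat}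
    (f : {ffun face R -> 'I_n}) : arc_constant R (point_coloring f).
Proof.
by apply/arc_constantP => p q /connect1/face_of_connect; rewrite !ffunE => ->.
Qed.

(** [point_coloring] is a bijection onto the arc-constant colorings. The predicate is left free to
    cover both all face colorings and the partial ones. *)
Lemma card_point_coloring {G : multigraph} (R : ribbon_graph G) (n : nat)
    (P : pred {ffun boundary_point G -> 'I_n}) :
  #|[set f : {ffun face R -> 'I_n} | P (point_coloring f)]|
    = #|[set g : {ffun boundary_point G -> 'I_n} | arc_constant R g & P g]|.
Proof.
rewrite -(card_imset _ (@point_coloring_inj G R n)); apply: eq_card => g.
rewrite inE; apply/imsetP/andP => [[f]|[gR Pg]].
  by rewrite inE => Pf ->; split=> //; apply: arc_constant_point_coloring.
have [f gf] := codom_point_coloring _ gR.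
by exists f; rewrite // inE -gf.
Qed.

Definition monochromatic_at {G : multigraph} {T : eqType}
    (g : boundary_point G -> T) (v : mg_vertex G) : bool :=
  [forall h : half_edge G, forall h' : half_edge G,
     (mg_end h == v) && (mg_end h' == v) ==>
       (g (inl (h, true)) == g (inl (h', true)))].

Lemma partial_face_coloringE {G : multigraph} {R : ribbon_graph G} {n : nat}
    (f : {ffun face R -> 'I_n}) :
  partial_face_coloring f =
    ~~ [exists v, monochromatic_at (point_coloring f) v].
Proof.
rewrite negb_exists; apply: eq_forallb => v.
rewrite negb_forall; apply: eq_existsb => h.
rewrite negb_forall; apply: eq_existsb => h'.
by rewrite negb_imply !ffunE andbA.
Qed.

Lemma card_face_colorings {G : multigraph} (R : ribbon_graph G) (n : nat) :
  (n ^ #|boundary_circles R|)%N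
    = #|[set g : {ffun boundary_point G -> 'I_n} | arc_constant R g]|.
Proof.
have := card_point_coloring R n predT.
rewrite cardsT card_ffun card_ord card_sig => ->.
by apply: eq_card => g; rewrite !inE andbT.
Qed.

Lemma num_partial_face_coloringsE {G : multigraph} (R : ribbon_graph G)
    (n : nat) :
  num_partial_face_colorings R n
    = #|[set g : {ffun boundary_point G -> 'I_n} | arc_constant R g
           & ~~ [exists v, monochromatic_at g v]]|.
Proof.
rewrite -(card_point_coloring R n
           (fun g => ~~ [exists v, monochromatic_at g v])).
by apply: eq_card => f; rewrite !inE partial_face_coloringE.
Qed.

Definition flip {G : multigraph} (v : mg_vertex G) (nu : state G) : state G :=
  [ffun w => nu w (+) (w == v)].

Lemma flipK {G : multigraph} (v : mg_vertex G) : involutive (flip v).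
Proof. by move=> nu; apply/ffunP => w; rewrite !ffunE -addbA addbb addbF. Qed.

Lemma sign_flip {G : multigraph} (v : mg_vertex G) (nu : state G) :
  (-1) ^+ state_size (flip v nu) = - (-1) ^+ state_size nu :> int.
Proof.
(* Splitting off [v] leaves a set that the flip does not change. *)
have sizeE mu : state_size mu = (mu v + #|[set w | mu w] :\ v|)%N.
  by rewrite /state_size (cardsD1 v) inE.
rewrite !sizeE !exprD ffunE eqxx addbT !signrE.
have -> : [set w | flip v nu w] :\ v = [set w | nu w] :\ v.
  by apply/setP => w; rewrite !inE ffunE; case: eqP; rewrite ?addbF.
by case: (nu v); rewrite /= ?expr0 ?expr1 !(mul1r, mulN1r) ?opprK.
Qed.

(** The point [(h, false)] lies across a corner from [(k, true)], where [k] is the predecessor of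
    [h] at the same vertex; so comparing the [true] points, one per corner, suffices. *)
Lemma monochromatic_points {G : multigraph} {R : ribbon_graph G} {T : eqType}
    {g : boundary_point G -> T} {v : mg_vertex G} {h : half_edge G}
    (b b' : bool) :
  arc_constant R g -> monochromatic_at g v -> mg_end h = v ->
  g (inl (h, b)) = g (inl (h, b')).
Proof.
move=> /arc_constantP gR mono hv.
have side : g (inl (h, false)) = g (inl (h, true)).
  have [k hk] : exists k, h = rg_rot R k.
    by exists ((rg_rot R)^-1%g h); rewrite permKV.
  have <- : g (inl (k, true)) = g (inl (h, false)).
    by apply: gR; rewrite /= hk eqxx.
  have kv : mg_end k = v by rewrite -hv hk mg_end_rot.
  by apply/eqP; move/forallP/(_ k)/forallP/(_ h)/implyP: mono; apply;
    rewrite kv hv eqxx.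
by case: b b' => [] [].
Qed.

Lemma arc_constant_flip {G : multigraph} (R : ribbon_graph G) {T : eqType}
    {g : boundary_point G -> T} {v : mg_vertex G} {nu : state G} :
  monochromatic_at g v ->
  arc_constant (state_graph R nu) g ->
  arc_constant (state_graph R (flip v nu)) g.
Proof.
move=> mono gnu; have /arc_constantP gR := gnu.
have swap h b b' : mg_end h = v -> g (inl (h, b)) = g (inl (h, b')).
  exact: monochromatic_points gnu mono.
apply/arc_constantP => -[[h b]|[u|[c b]]] [[h' b']|[u'|[c' b']]] //=; last first.
  by move=> ?; apply: gR.
case/or3P=> [corner|corner|/andP[/eqP-> /eqP->]].
- by apply: gR; rewrite /= corner.
- by apply: gR; rewrite /= corner orbT.
have band d : g (inl (h, d)) = g (inl (opposite h, d (+) ~~ state_neg R nu (inl h.1))).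
  by apply: gR; rewrite /= !eqxx /= !orbT.
have [hv|/eqP hv] := eqVneq (mg_end h) v.
  have [ov|/eqP ov] := eqVneq (mg_end (opposite h)) v.
    by rewrite band; apply: swap.
  rewrite (swap h b (~~ b) hv) band; congr (g (inl (_, _))).
  (* Only the end [h] lies at [v], so the flip toggles the sign once and this cancels the negation
     of [b]. *)
  move: hv ov; case: h {band} => e [] /= hv /eqP/negbTE ov;
    rewrite !ffunE /opposite /= in ov *; rewrite hv eqxx ov;
    by case: b (rg_neg R _) (nu _) (nu _) => [] [] [] [].
have [ov|/eqP ov] := eqVneq (mg_end (opposite h)) v.
  by rewrite band; apply: swap.
rewrite band; congr (g (inl (_, _ (+) ~~ _))).
by move: hv ov; case: h {band} => e [] /= /eqP/negbTE hv /eqP/negbTE ov;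
  rewrite !ffunE /opposite /= in ov *; rewrite hv ov !addbF.
Qed.

(** Flipping at [v] is a sign-reversing involution of the compatible states, so the sum equals its
    own opposite. *)
Lemma sum_states_monochromatic {G : multigraph} (R : ribbon_graph G) {T : eqType}
    {g : boundary_point G -> T} {v : mg_vertex G} :
  monochromatic_at g v ->
  \sum_(nu : state G | arc_constant (state_graph R nu) g)
     (-1) ^+ state_size nu = 0 :> int.
Proof.
move=> mono; set S := LHS.
suff SN : S = - S.
  by apply/eqP; rewrite -Num.Theory.eqNr -SN.
rewrite {1}/S (reindex_inj (inv_inj (flipK v))) -sumrN.
apply: eq_big => [nu|nu _]; last exact: sign_flip.
by apply/idP/idP => /(arc_constant_flip _ mono); rewrite ?flipK.
Qed.

Lemma horner_vertex_poly {G : multigraph} (R : ribbon_graph G) (x : int) :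
  (vertex_poly R).[x] =
    \sum_(nu : state G)
      (-1) ^+ state_size nu * x ^+ #|boundary_circles (state_graph R nu)|.
Proof.
rewrite /vertex_poly horner_sum; apply: eq_bigr => nu _.
by rewrite -(rmorph_sign polyC) hornerCM hornerXn.
Qed.

Theorem theorem7p1 (G : multigraph) (R : ribbon_graph G)
    (hconn : graph_connected G) (htri : trivalent G) (n : nat) :
  (vertex_poly R).[n%:R] =
    \sum_(nu : state G | ~~ odd (state_size nu))
       (num_partial_face_colorings (state_graph R nu) n)%:R
    - \sum_(nu : state G | odd (state_size nu))
       (num_partial_face_colorings (state_graph R nu) n)%:R.
Proof.
(* Counting by a sum of ones over colorings of a state-independent set allows the sums over states
   and colorings to be exchanged. *)
pose num (P : pred {ffun boundary_point G -> 'I_n}) (nu : state G) : int :=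
  \sum_(g : {ffun boundary_point G -> 'I_n}
       | arc_constant (state_graph R nu) g && P g) 1.
pose mono (g : {ffun boundary_point G -> 'I_n}) :=
  [exists v, monochromatic_at g v].
transitivity (\sum_(nu : state G) (-1) ^+ state_size nu * num (predC mono) nu).
  rewrite horner_vertex_poly.
  under eq_bigr => nu _.
    rewrite -natrX card_face_colorings -sum1dep_card natr_sum (bigID mono) /=.
    rewrite mulrDr; over.
  (* The first summand gathers the colorings with a monochromatic vertex and has to vanish. *)
  rewrite big_split /= -[RHS]add0r; congr (_ + _).
  under eq_bigr => nu _ do rewrite mulr_sumr.
  rewrite (exchange_big_dep mono) /= => [|? ? _ /andP[]//].
  apply: big1 => g mono_g; have /existsP[v gv] := mono_g.
  rewrite -[RHS](sum_states_monochromatic R gv).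
  by apply: eq_big => [nu|nu _]; rewrite ?mono_g ?andbT ?mulr1.
have numE nu : (num_partial_face_colorings (state_graph R nu) n)%:R
    = num (predC mono) nu.
  by rewrite num_partial_face_coloringsE -sum1dep_card natr_sum.
(* The sign is now resolved by the parity of the state. *)
rewrite (bigID (fun nu : state G => odd (state_size nu))) /= addrC -sumrN.
by congr (_ + _); apply: eq_bigr => nu odd_nu;
  rewrite numE -signr_odd ?odd_nu ?(negbTE odd_nu) ?mul1r ?mulN1r.
Qed.
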